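(* Let $f$ be an L-additive function with associated completely multiplicative function $h_f$. Let $n=q_1q_2\cdots q_r=p_1^{n_1}p_2^{n_2}\cdots p_s^{n_s}$, where $q_1,\ldots,q_r$ are primes (not necessarily distinct) and $p_1,\ldots,p_s$ are distinct primes. Then $$f(n)=\sum_{i=1}^r h_f(q_1)\cdots h_f(q_{i-1})\,f(q_i)\,h_f(q_{i+1})\cdots h_f(q_r).$$ If, moreover, $h_f(p_1),\dots,h_f(p_s)\ne 0$, then $$f(n)=h_f(n)\sum_{i=1}^r\frac{f(q_i)}{h_f(q_i)}=h_f(n)\sum_{i=1}^s\frac{n_i f(p_i)}{h_f(p_i)}.$$
   Context: An arithmetic function is a complex-valued function on the positive integers. An arithmetic function $h$ is completely multiplicative if $h(1)=1$ and $h(mn)=h(m)h(n)$ for all positive integers $m,n$. An arithmetic function $f$ is L-additive (Leibniz-additive) if there is a completely multiplicative function $h_f$ such that $f(mn)=f(m)h_f(n)+f(n)h_f(m)$ for all positive integers $m,n$; ''L-additive with associated $h_f$'' means that $h_f$ is such a function. *)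

(* Defs.v *)
From mathcomp Require Import all_boot all_order all_algebra.
From mathcomp Require Import reals complex.

Set Implicit Arguments.
Unset Strict Implicit.
Unset Printing Implicit Defensive.

Import Order.TTheory GRing.Theory Num.Theory.

Local Open Scope ring_scope.
Local Open Scope complex_scope.

(* Arithmetic functions are represented by functions on [nat]; all conditions
   quantify over positive integers only, so the value at 0 is irrelevant. *)
Definition arith_fun (R : realType) : Type := nat -> R[i].

Definition completely_multiplicative (R : realType) (h : arith_fun R) : Prop :=
  h 1%N = 1 /\
  forall m n : nat, (0 < m)%N -> (0 < n)%N -> h (m * n)%N = h m * h n.

Definition L_additive_with (R : realType) (f hf : arith_fun R) : Prop :=
  completely_multiplicative hf /\
  forall m n : nat, (0 < m)%N -> (0 < n)%N ->
    f (m * n)%N = f m * hf n + f n * hf m.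

Definition L_additive (R : realType) (f : arith_fun R) : Prop :=
  exists hf : arith_fun R, L_additive_with f hf.

(* Main.v *)
Require Import Defs.
From mathcomp Require Import all_boot all_order all_algebra.
From mathcomp Require Import reals complex.

(** For the first formula, peel off the last prime factor: the Leibniz rule
    multiplies every earlier term by [hf] of the new factor and adds one term
    in which [f] falls on that factor ([L_additive_prod]).

    For the quotient formulas, divide the Leibniz rule by
    [hf (m * n) = hf m * hf n]: where [hf] does not vanish, the logarithmic
    derivative [m |-> f m / hf m] turns products into sums ([logder_prod]).
    Applying this to each of the two factorizations of [n] evaluates the same
    number [f n / hf n] in two ways, which gives both sums at once.  The
    non-vanishing of [hf] at the [p i] passes to the [q i], because every prime
    dividing [n] is one of the [p i] ([prime_dvd_prod_primes]). *)

Set Implicit Arguments.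
Unset Strict Implicit.
Unset Printing Implicit Defensive.

Import Order.TTheory GRing.Theory Num.Theory.

Local Open Scope ring_scope.

(** Euclid's lemma, iterated over the factors and over each exponent. *)
Lemma prime_dvd_prod_primes (I : finType) (p e : I -> nat) (k : nat) :
  (forall i, prime (p i)) -> prime k -> (k %| \prod_i p i ^ e i)%N ->
  exists i, k = p i.
Proof.
move=> p_prime k_prime; rewrite Euclid_dvd_prod //.
rewrite big_has => /hasP[i _]; rewrite Euclid_dvdX // => /andP[+ _].
by rewrite dvdn_prime2 // => /eqP ->; exists i.
Qed.

Lemma completely_multiplicative_prod (R : realType) (h : arith_fun R)
    (I : Type) (t : seq I) (F : I -> nat) :
  completely_multiplicative h -> (forall i, 0 < F i)%N ->
  h (\prod_(i <- t) F i)%N = \prod_(i <- t) h (F i).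
Proof.
move=> [h1 hM] F_gt0; elim: t => [|i t IHt]; first by rewrite !big_nil.
by rewrite !big_cons hM ?IHt // prodn_gt0.
Qed.

Section LeibnizAdditive.

Variables (R : realType) (f hf : arith_fun R).
Hypothesis hfL : L_additive_with f hf.

Let hf1 : hf 1%N = 1. Proof. by case: hfL => -[]. Qed.

Let hfM m n : (0 < m)%N -> (0 < n)%N -> hf (m * n)%N = hf m * hf n.
Proof. by case: hfL => -[_ +] _; apply. Qed.

Let fM m n : (0 < m)%N -> (0 < n)%N -> f (m * n)%N = f m * hf n + f n * hf m.
Proof. by case: hfL => _; apply. Qed.

(** The Leibniz rule at [1 * 1] reads [f 1 = f 1 + f 1]. *)
Lemma L_additive1 : f 1%N = 0.
Proof.
have := @fM 1 1 isT isT; rewrite muln1 hf1 mulr1 => /eqP.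
by rewrite -subr_eq subrr eq_sym => /eqP.
Qed.

(** Induction on the last factor keeps the order of the indices: the new index
    lies after all the old ones, so it enlarges only the right-hand products. *)
Lemma L_additive_prod (r : nat) (q : 'I_r -> nat) :
  (forall i, 0 < q i)%N ->
  f (\prod_(i < r) q i)%N
    = \sum_(i < r) ((\prod_(j < r | (j < i)%N) hf (q j)) * f (q i)
                      * (\prod_(j < r | (i < j)%N) hf (q j))).
Proof.
elim: r q => [|r IHr] q q_gt0; first by rewrite !big_ord0 L_additive1.
rewrite big_ord_recr /= fM ?prodn_gt0 // IHr //.
rewrite completely_multiplicative_prod ?(proj1 hfL) // [RHS]big_ord_recr /=.
congr (_ + _).
  (* The new index is absent from [j < i] and contributes [hf] of the last
     factor to [i < j]. *)
  rewrite mulr_suml; apply: eq_bigr => i _.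
  rewrite [in RHS]big_mkcond big_ord_recr /= ltnNge (ltnW (ltn_ord i)) mulr1.
  rewrite -big_mkcond /= [X in _ = _ * X]big_mkcond big_ord_recr /= ltn_ord.
  by rewrite -big_mkcond /= !mulrA.
rewrite [X in _ = _ * X]big1 => [|j]; last by rewrite ltnNge -ltnS ltn_ord.
rewrite mulr1 mulrC; congr (_ * _).
rewrite [RHS]big_mkcond big_ord_recr /= ltnn mulr1.
by apply: eq_bigr => i _; rewrite ltn_ord.
Qed.

Lemma hf_prod_neq0 (I : Type) (t : seq I) (F : I -> nat) :
  (forall i, 0 < F i)%N -> (forall i, hf (F i) != 0) ->
  hf (\prod_(i <- t) F i)%N != 0.
Proof.
move=> F_gt0 hF; rewrite completely_multiplicative_prod ?(proj1 hfL) //.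
by elim/big_ind: _ => //; [exact: oner_neq0 | exact: mulf_neq0].
Qed.

Lemma logderM m n :
  (0 < m)%N -> (0 < n)%N -> hf m != 0 -> hf n != 0 ->
  f (m * n)%N / hf (m * n)%N = f m / hf m + f n / hf n.
Proof.
by move=> m_gt0 n_gt0 hm hn; rewrite fM // hfM // addf_div.
Qed.

(** The empty product is where [f 1 = 0] enters; it makes the formula hold at
    [n = 1]. *)
Lemma logder_prod (I : Type) (t : seq I) (F : I -> nat) :
  (forall i, 0 < F i)%N -> (forall i, hf (F i) != 0) ->
  f (\prod_(i <- t) F i)%N / hf (\prod_(i <- t) F i)%N
    = \sum_(i <- t) f (F i) / hf (F i).
Proof.
move=> F_gt0 hF; elim: t => [|i t IHt].
  by rewrite !big_nil L_additive1 mul0r.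
by rewrite !big_cons logderM ?IHt ?prodn_gt0 ?hf_prod_neq0.
Qed.

Lemma hf_expn m k : (0 < m)%N -> hf (m ^ k)%N = hf m ^+ k.
Proof.
move=> m_gt0; elim: k => [|k IHk]; first by rewrite expn0 hf1.
by rewrite expnS hfM ?expn_gt0 ?m_gt0 // IHk exprS.
Qed.

Lemma logder_expn m k :
  (0 < m)%N -> hf m != 0 ->
  f (m ^ k)%N / hf (m ^ k)%N = k%:R * f m / hf m.
Proof.
move=> m_gt0 hm; elim: k => [|k IHk].
  by rewrite expn0 L_additive1 !mul0r.
rewrite expnS logderM ?expn_gt0 ?m_gt0 ?hf_expn ?expf_neq0 //.
by rewrite -hf_expn // IHk -[k.+1]add1n natrD !mulrDl mul1r.
Qed.

End LeibnizAdditive.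

Theorem theorem2p4 (R : realType) (f hf : arith_fun R)
    (hfL : L_additive_with f hf)
    (n r s : nat) (q : 'I_r -> nat) (p e : 'I_s -> nat)
    (q_prime : forall i, prime (q i))
    (p_prime : forall i, prime (p i))
    (p_inj : injective p)
    (n_q : n = (\prod_(i < r) q i)%N)
    (n_p : n = (\prod_(i < s) p i ^ e i)%N) :
  f n = \sum_(i < r) ((\prod_(j < r | (j < i)%N) hf (q j)) * f (q i)
                        * (\prod_(j < r | (i < j)%N) hf (q j)))
  /\ ((forall i, hf (p i) != 0) ->
      f n = hf n * (\sum_(i < r) f (q i) / hf (q i))
      /\ hf n * (\sum_(i < r) f (q i) / hf (q i))
         = hf n * (\sum_(i < s) (e i)%:R * f (p i) / hf (p i))).
Proof.
have q_gt0 i : (0 < q i)%N by rewrite prime_gt0.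
have p_gt0 i : (0 < p i)%N by rewrite prime_gt0.
have pe_gt0 i : (0 < p i ^ e i)%N by rewrite expn_gt0 p_gt0.
split; first by rewrite n_q; apply: L_additive_prod.
move=> hp.
have hpe i : hf (p i ^ e i)%N != 0 by rewrite (hf_expn hfL) // expf_neq0.
have hq i : hf (q i) != 0.
  have [||j ->] := @prime_dvd_prod_primes _ p e (q i) p_prime => //.
  by rewrite -n_p n_q (bigD1 i) //= dvdn_mulr.
have hn : hf n != 0 by rewrite n_q (hf_prod_neq0 hfL).
have n_sum_q : f n / hf n = \sum_(i < r) f (q i) / hf (q i).
  by rewrite n_q (logder_prod hfL).
have n_sum_p : f n / hf n = \sum_(i < s) (e i)%:R * f (p i) / hf (p i).
  rewrite {1 2}n_p (logder_prod hfL) //.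
  by apply: eq_bigr => i _; rewrite (logder_expn hfL).
by rewrite -n_sum_q -n_sum_p mulrC divfK.
Qed.
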